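(* Let $A,M\in\mathbb{C}^{n\times n}$ be Hermitian with $M$ positive definite, and let the eigenvalues of the pair $(A,M)$ be $\lambda_1<\lambda_2\le\cdots\le\lambda_n$. Put $A_{\lambda_1}=A-\lambda_1 M$. Let $\sigma<\lambda_1$, $A_\sigma=A-\sigma M$, let $T\in\mathbb{C}^{n\times n}$ be Hermitian positive definite and $\kappa=\operatorname{cond}_2(T^{1/2}A_\sigma T^{1/2})$ (the ratio of the largest to the smallest eigenvalue of $T^{1/2}A_\sigma T^{1/2}$). Let $x^{(0)}\in\mathbb{C}^n$ be neither an eigenvector of $(A,M)$ associated with $\lambda_1$ nor $M$-orthogonal to the eigenspace associated with $\lambda_1$, and let $x^{(0)},x^{(1)},\ldots$ be the iterates of the following heuristic preconditioned CG iteration (for as long as it is defined): set $r^{(0)}=-A_{\lambda_1}x^{(0)}$, $\gamma^{(0)}=(Tr^{(0)})^*r^{(0)}$, $p^{(0)}=Tr^{(0)}$, and for $i=0,1,\ldots$: $w=A_{\lambda_1}p^{(i)}$, $\delta=\gamma^{(i)}/(w^*p^{(i)})$, $x^{(i+1)}=x^{(i)}+\delta p^{(i)}$, $r^{(i+1)}=r^{(i)}-\delta w$, $\gamma^{(i+1)}=(Tr^{(i+1)})^*r^{(i+1)}$, $p^{(i+1)}=Tr^{(i+1)}+(\gamma^{(i+1)}/\gamma^{(i)})p^{(i)}$. Let $\lambda^{(i)}=\frac{x^{(i)*}Ax^{(i)}}{x^{(i)*}Mx^{(i)}}$. Then for $i=0,1,\ldots$, $$\lambda^{(i)}-\lambda_1\le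 \big(\mathcal{C}_i(\varphi)\big)^{-2}\frac{\|x^{(0)}\|_M^2}{\|x^{(i)}\|_M^2}(\lambda^{(0)}-\lambda_1),\qquad \varphi=\frac{\eta+1}{\eta-1},\quad \eta=\kappa\,\frac{(\lambda_n-\lambda_1)(\lambda_2-\sigma)}{(\lambda_2-\lambda_1)(\lambda_n-\sigma)}.$$
   Context: $\mathcal{C}_i$ is the Chebyshev polynomial of the first kind of degree $i$. $\|y\|_M=(y^*My)^{1/2}$. $T^{1/2}$ is the Hermitian positive definite square root of $T$. *)

(* Defs.v *)
From HB Require Import structures.
From mathcomp Require Import all_boot all_order all_algebra.
From mathcomp Require Import complex reals.
Set Implicit Arguments.
Unset Strict Implicit.
Unset Printing Implicit Defensive.
Import Order.TTheory GRing.Theory Num.Theory.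
Local Open Scope ring_scope.
Local Open Scope sesquilinear_scope.

Section Defs.
Variable R : realType.
Local Notation C := R[i].
Variable n : nat.

Definition dotc (u v : 'cV[C]_n) : C := (u ^t* *m v) 0 0.

Definition normM2 (M : 'M[C]_n) (y : 'cV[C]_n) : C := dotc y (M *m y).

Definition posdef (A : 'M[C]_n) : Prop :=
  forall v : 'cV[C]_n, v != 0 -> 0 < dotc v (A *m v).

Definition pencil_charpoly (A M : 'M[C]_n) : {poly C} :=
  \det (map_mx (fun c => c *: 'X) M - map_mx polyC A).

Definition pencil_eigenvalues (A M : 'M[C]_n) (lam : nat -> R) : Prop :=
  pencil_charpoly A M = (\det M) *: \prod_(i < n) ('X - ((lam i)%:C)%C%:P)
  /\ (forall i j, (i <= j < n)%N -> lam i <= lam j).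

Definition mx_eigenvalues (B : 'M[C]_n) (mu : nat -> R) : Prop :=
  char_poly B = \prod_(i < n) ('X - ((mu i)%:C)%C%:P)
  /\ (forall i j, (i <= j < n)%N -> mu i <= mu j).

Definition rayleigh (A M : 'M[C]_n) (x : 'cV[C]_n) : C :=
  dotc x (A *m x) / dotc x (M *m x).

(* State of the heuristic PCG iteration: (x, r, p, gamma) *)
Definition pcg_state := ('cV[C]_n * 'cV[C]_n * 'cV[C]_n * C)%type.

Definition pcg_init (Al T : 'M[C]_n) (x0 : 'cV[C]_n) : pcg_state :=
  let r0 := - (Al *m x0) in
  (x0, r0, T *m r0, dotc (T *m r0) r0).

Definition pcg_step (Al T : 'M[C]_n) (s : pcg_state) : pcg_state :=
  let: (x, r, p, g) := s in
  let w := Al *m p in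
  let delta := g / dotc w p in
  let x' := x + delta *: p in
  let r' := r - delta *: w in
  let g' := dotc (T *m r') r' in
  let p' := T *m r' + (g' / g) *: p in
  (x', r', p', g').

Definition pcg (Al T : 'M[C]_n) (x0 : 'cV[C]_n) (i : nat) : pcg_state :=
  iter i (pcg_step Al T) (pcg_init Al T x0).

Definition pcg_x Al T x0 i := (pcg Al T x0 i).1.1.1.
Definition pcg_p Al T x0 i := (pcg Al T x0 i).1.2.
Definition pcg_gamma Al T x0 i := (pcg Al T x0 i).2.

(* the iterates x^(0..i) are defined: no division by zero occurs *)
Definition pcg_defined (Al T : 'M[C]_n) (x0 : 'cV[C]_n) (i : nat) : Prop :=
  (forall j, (j < i)%N ->
     dotc (Al *m pcg_p Al T x0 j) (pcg_p Al T x0 j) != 0) /\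
  (forall j, (j.+1 < i)%N -> pcg_gamma Al T x0 j != 0).

End Defs.

Fixpoint cheb_pair {R : nzRingType} (k : nat) : {poly R} * {poly R} :=
  match k with
  | 0 => (1, 'X)
  | k.+1 => let: (a, b) := cheb_pair k in (b, 2%:R *: 'X * b - a)
  end.

Definition chebyshev {R : nzRingType} (k : nat) : {poly R} := (cheb_pair k).1.

(* Main.v *)
Require Import Defs.
From HB Require Import structures.
From mathcomp Require Import all_boot all_order all_algebra.
From mathcomp Require Import complex reals.
From mathcomp Require Import perm ring lra.
Set Implicit Arguments.
Unset Strict Implicit.
Unset Printing Implicit Defensive.
Import Order.TTheory GRing.Theory Num.Theory.
Local Open Scope ring_scope.
Local Open Scope sesquilinear_scope.

(* Since [rayleigh A M x - lam1] is [dotc x (Al x) / dotc x (M x)], only the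
   energy [dotc x (Al x)] must be bounded. The residual of the k-th CG iterate
   is orthogonal to all earlier search directions although [Al] is singular,
   hence the iterate has least energy among all [q(T Al) x0] with [q 0 = 1] and
   [deg q <= k]. Expanding [x0] in eigenvectors of [T Al], a rescaled Chebyshev
   polynomial contracts the energy by [C_k(phi)^-2], provided the nonzero
   eigenvalues of [S Al S] lie in an interval [[a, b]] with [b / a = eta].

   With [As = A - sigma M] and [c(t) = (t - lam1) / (t - sigma)], the upper end
   [b = mu_max c(lamn)] follows from [Al <= c(lamn) As]. For the lower end
   [a = mu_min c(lam2)], an eigenvector of [S Al S] with nonzero eigenvalue is
   orthogonal to the kernel, so moving it along the kernel until it is
   As-orthogonal to that kernel keeps its energy and does not shorten it, and
   there [c(lam2) As <= Al]. *)

(** * Hermitian forms and simultaneous diagonalisation of a pencil *)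

Section Hermitian.
Variable R : realType.
Local Notation C := R[i].

(** The entries come from [R], so that eigenvalues are compared in a totally ordered field and the
    matrix is Hermitian. *)
Definition cdiag {n} (d : 'I_n -> R) : 'M[C]_n := diag_mx (\row_i ((d i)%:C)%C).

Lemma adjmxM {m n p} (A : 'M[C]_(m, n)) (B : 'M[C]_(n, p)) :
  (A *m B) ^t* = B ^t* *m A ^t*.
Proof. by rewrite trmx_mul map_mxM. Qed.

Lemma hermsymmxP {n} {A : 'M[C]_n} : reflect (A ^t* = A) (A \is hermsymmx).
Proof.
by apply: (iffP (is_hermitianmxP _ _ _)); rewrite expr0 scale1r => /esym.
Qed.

Lemma conj_real_complex (x : R) : ((x%:C)%C : C)^* = (x%:C)%C.
Proof. by apply: conj_Creal; apply/complex_realP; exists x. Qed.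

Lemma cdiag_adj {n} (d : 'I_n -> R) : (cdiag d) ^t* = cdiag d.
Proof.
rewrite /cdiag tr_diag_mx map_diag_mx; congr diag_mx.
by apply/rowP => i; rewrite !mxE; apply: conj_real_complex.
Qed.

Section Dotc.
Variable n : nat.
Implicit Types (u v w : 'cV[C]_n) (A B : 'M[C]_n).

Lemma dotcE u v : dotc u v = \sum_i (u i 0)^* * v i 0.
Proof. by rewrite /dotc mxE; apply: eq_bigr => i _; rewrite !mxE. Qed.

Lemma dotcDl u v w : dotc (u + v) w = dotc u w + dotc v w.
Proof.
by rewrite !dotcE -big_split; apply: eq_bigr => i _; rewrite !mxE rmorphD mulrDl.
Qed.

Lemma dotcDr u v w : dotc w (u + v) = dotc w u + dotc w v.
Proof. by rewrite /dotc mulmxDr mxE. Qed.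

Lemma dotcZl c u v : dotc (c *: u) v = c^* * dotc u v.
Proof.
by rewrite !dotcE mulr_sumr; apply: eq_bigr => i _; rewrite !mxE rmorphM mulrA.
Qed.

Lemma dotcZr c u v : dotc u (c *: v) = c * dotc u v.
Proof. by rewrite /dotc -scalemxAr mxE. Qed.

Lemma dotcNl u v : dotc (- u) v = - dotc u v.
Proof. by rewrite -scaleN1r dotcZl rmorphN1 mulN1r. Qed.

Lemma dotcNr u v : dotc u (- v) = - dotc u v.
Proof. by rewrite -scaleN1r dotcZr mulN1r. Qed.

Lemma dotcBl u v w : dotc (u - v) w = dotc u w - dotc v w.
Proof. by rewrite dotcDl dotcNl. Qed.

Lemma dotcBr u v w : dotc w (u - v) = dotc w u - dotc w v.
Proof. by rewrite dotcDr dotcNr. Qed.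

Lemma dotc0r u : dotc u 0 = 0.
Proof. by rewrite /dotc mulmx0 mxE. Qed.

Lemma dotc0l u : dotc 0 u = 0.
Proof. by rewrite -(scale0r u) dotcZl rmorph0 mul0r. Qed.

Lemma dotc_sumr I (r : seq I) (P : pred I) (F : I -> 'cV[C]_n) u :
  dotc u (\sum_(i <- r | P i) F i) = \sum_(i <- r | P i) dotc u (F i).
Proof. exact: (big_morph (dotc u) (fun v w => dotcDr v w u) (dotc0r u)). Qed.

Lemma dotcC u v : (dotc u v)^* = dotc v u.
Proof.
rewrite !dotcE rmorph_sum; apply: eq_bigr => i _.
by rewrite rmorphM /= conjCK mulrC.
Qed.

Lemma dotc_mull A u v : dotc (A *m u) v = dotc u (A ^t* *m v).
Proof. by rewrite /dotc adjmxM mulmxA. Qed.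

Lemma dotc_herm A u v : A \is hermsymmx -> dotc (A *m u) v = dotc u (A *m v).
Proof. by move/hermsymmxP => hA; rewrite dotc_mull hA. Qed.

Lemma dotc_ge0 u : 0 <= dotc u u.
Proof. by rewrite dotcE sumr_ge0 // => i _; rewrite mulrC mul_conjC_ge0. Qed.

Lemma dotc_cdiag (P A : 'M[C]_n) d w : P ^t* *m A *m P = cdiag d ->
  dotc (P *m w) (A *m (P *m w)) = \sum_i ((d i)%:C)%C * `|w i 0| ^+ 2.
Proof.
move=> h; rewrite dotc_mull !mulmxA h dotcE; apply: eq_bigr => i _.
by rewrite mul_diag_mx !mxE mulrCA normCKC.
Qed.

End Dotc.

Lemma hermitian_diag n (A : 'M[C]_n) : A \is hermsymmx ->
  exists (V : 'M[C]_n) (d : 'I_n -> R),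
    [/\ V ^t* *m V = 1%:M, V *m V ^t* = 1%:M & V ^t* *m A *m V = cdiag d].
Proof.
move=> hA; have := hermitian_normalmx hA => /orthomx_spectralP.
have /unitarymxP uV := spectral_unitarymx A.
have rV := hermitian_spectral_diag_real hA.
rewrite invmx_unitary ?spectral_unitarymx //.
set V := spectralmx A in uV *; set D := spectral_diag A in rV * => e.
exists (V ^t*), (fun i => complex.Re (D 0 i)); rewrite trmxCK; split=> //.
  exact: mulmx1C.
rewrite {1}e !mulmxA uV mul1mx -mulmxA uV mulmx1; congr diag_mx.
by apply/rowP => i; rewrite mxE RRe_real //; apply: (mxOverP rV).
Qed.

Lemma herm_conj n (P A : 'M[C]_n) : A \is hermsymmx -> P ^t* *m A *m P \is hermsymmx.
Proof.
move/hermsymmxP => hA; apply/hermsymmxP.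
by rewrite !adjmxM trmxCK hA mulmxA.
Qed.

Lemma posdef_diag_gt0 n (P A : 'M[C]_n) (d : 'I_n -> R) : posdef A ->
  P \in unitmx -> P ^t* *m A *m P = cdiag d -> forall i, 0 < d i.
Proof.
move=> pA uP h i.
have e0 : P *m delta_mx i 0 != 0 :> 'cV[C]_n.
  apply/eqP => /(congr1 (mulmx (invmx P))); rewrite mulKmx // mulmx0.
  by move/colP/(_ i); rewrite !mxE !eqxx => /eqP; rewrite oner_eq0.
have := pA _ e0; rewrite (dotc_cdiag _ h) (bigD1 i) //= big1 ?addr0.
  by rewrite !mxE !eqxx normr1 expr1n mulr1 -[0]/((0%:C)%C) ltcR.
by move=> j /negPf ne; rewrite !mxE ne normr0 expr0n mulr0.
Qed.

(** Scaling the unitary eigenbasis of [M] by the inverse square roots of its eigenvalues gives a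
    congruence [L] taking [M] to the identity. A unitary change of basis then diagonalises the
    transformed [A] without disturbing that identity. *)
Lemma pencil_diag n (A M : 'M[C]_n) : A \is hermsymmx -> M \is hermsymmx ->
  posdef M -> exists (P : 'M[C]_n) (d : 'I_n -> R),
    [/\ P \in unitmx, P ^t* *m M *m P = 1%:M & P ^t* *m A *m P = cdiag d].
Proof.
move=> hA hM pM; have [V [m [uV1 uV2 eV]]] := hermitian_diag hM.
have uV : V \in unitmx by case: (mulmx1_unit uV1).
have m0 := posdef_diag_gt0 pM uV eV.
have [L eL] : exists L : 'M[C]_n, L ^t* *m M *m L = 1%:M.
  exists (V *m cdiag (fun i => (Num.sqrt (m i))^-1)).
  rewrite adjmxM cdiag_adj !mulmxA -(mulmxA _ _ M) -(mulmxA _ _ V) eV.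
  rewrite -!mulmxA /cdiag !mulmx_diag -[1%:M]diag_const_mx; congr diag_mx.
  apply/rowP => i; rewrite !mxE -!rmorphM; congr (_ %:C)%C.
  rewrite mulrA mulrAC -expr2 exprVn sqr_sqrtr ?ltW // mulVf //.
  by rewrite gt_eqF.
have [W [d [uW1 uW2 eW]]] := hermitian_diag (herm_conj L hA).
exists (L *m W), d; split.
- have [_ uL] := mulmx1_unit eL; have [_ uW] := mulmx1_unit uW1.
  by rewrite unitmx_mul uL.
- by rewrite adjmxM !mulmxA -(mulmxA _ _ M) -(mulmxA _ _ L) eL mulmx1.
- by rewrite adjmxM -eW !mulmxA.
Qed.

Lemma posdef_unitmx n (A : 'M[C]_n) : A \is hermsymmx -> posdef A -> A \in unitmx.
Proof.
move=> hA pA; have [P [_ [_ e _]]] := pencil_diag hA hA pA.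
move: e; rewrite -mulmxA => /mulmx1_unit[_].
by rewrite unitmx_mul => /andP[].
Qed.

(** The congruence by [P] multiplies the pencil polynomial by a constant, which [eM] shows to be the
    inverse of [\det M]. Both lists are thus roots of one monic polynomial, and unique factorisation
    gives the permutation. *)
Lemma pencil_diag_perm n (A M P : 'M[C]_n) (d : 'I_n -> R) (lam : nat -> R) :
  P ^t* *m M *m P = 1%:M -> P ^t* *m A *m P = cdiag d ->
  pencil_eigenvalues A M lam -> exists s : 'S_n, forall i, d i = lam (s i).
Proof.
move=> eM eA [chi _].
have cdet : \det (P ^t*) * \det M * \det P = 1 by rewrite -!det_mulmx eM det1.
have prodE : \prod_(i < n) ('X - ((d i)%:C)%C%:P) =
             \prod_(i < n) ('X - ((lam i)%:C)%C%:P) :> {poly C}.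
  have <- : char_poly (cdiag d) = \prod_(i < n) ('X - ((d i)%:C)%C%:P).
    rewrite char_poly_trig; last by apply: diag_mx_is_trig.
    by apply: eq_bigr => i _; rewrite !mxE eqxx mulr1n.
  have -> : char_poly (cdiag d) = \det (P ^t*) *: (\det P *: pencil_charpoly A M).
    rewrite -!mul_polyC -!det_map_mx mulrA mulrAC -!det_mulmx; congr (\det _).
    rewrite /char_poly_mx -eA mulmxBr mulmxBl !map_mxM; congr (_ - _).
    have -> : map_mx (fun c => c *: 'X) M = 'X *: map_mx polyC M.
      by apply/matrixP => i j; rewrite !mxE -mul_polyC mulrC.
    by rewrite -scalemxAr -scalemxAl -!map_mxM eM map_mx1 scalemx1.
  by rewrite chi !scalerA [X in X *: _](_ : _ = 1) ?scale1r // -cdet; ring.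
have /prod_XsubC_eq : \prod_(x <- [tuple ((d i)%:C)%C | i < n]) ('X - x%:P) =
          \prod_(x <- [tuple ((lam i)%:C)%C | i < n]) ('X - x%:P) :> {poly C}.
  rewrite !big_tuple; under eq_bigr do rewrite tnth_mktuple.
  by rewrite prodE; under [RHS]eq_bigr do rewrite tnth_mktuple.
move/tuple_permP => [s es]; exists s => i; apply: complexI.
have := congr1 (nth 0 ^~ i) es.
by rewrite -!tnth_nth !tnth_mktuple.
Qed.

End Hermitian.

(** * Orthogonality relations and optimality of the preconditioned CG iterates *)

Section ConjugateGradients.
Variables (R : realType) (n : nat).
Local Notation C := R[i].
Variables (Al T : 'M[C]_n) (x0 : 'cV[C]_n).
Hypotheses (hAl : Al \is hermsymmx) (hT : T \is hermsymmx).

Local Notation x := (pcg_x Al T x0).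
Local Notation p := (pcg_p Al T x0).
Local Notation g := (pcg_gamma Al T x0).

Definition pcg_r i := (pcg Al T x0 i).1.1.2.
Local Notation r := pcg_r.

Definition pcg_den i := dotc (Al *m p i) (p i).
Local Notation den := pcg_den.

Lemma pcg_xS i : x i.+1 = x i + (g i / den i) *: p i.
Proof. by rewrite /pcg_den /pcg_x /pcg_p /pcg_gamma /=; case: (pcg _ _ _ i) => [[[]]]. Qed.

Lemma pcg_rS i : r i.+1 = r i - (g i / den i) *: (Al *m p i).
Proof.
by rewrite /pcg_den /pcg_r /pcg_p /pcg_gamma /=; case: (pcg _ _ _ i) => [[[]]].
Qed.

Lemma pcg_gammaE i : g i = dotc (T *m r i) (r i).
Proof.
by rewrite /pcg_r /pcg_gamma; case: i => [//|i] /=; case: (pcg _ _ _ i) => [[[]]].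
Qed.

Lemma pcg_pS i : p i.+1 = T *m r i.+1 + (g i.+1 / g i) *: p i.
Proof.
by rewrite /pcg_r /pcg_p /pcg_gamma /=; case: (pcg _ _ _ i) => [[[]]].
Qed.

Lemma pcg_rE i : r i = - (Al *m x i).
Proof.
by elim: i => [//|i IH]; rewrite pcg_rS IH pcg_xS mulmxDr scalemxAr opprD.
Qed.

(** Since [dotc] is conjugate-linear on the left, coefficients pulled out on that side come out
    conjugated. This lemma and the next remove those conjugations. *)
Lemma pcg_gamma_conj i : (g i)^* = g i.
Proof. by rewrite pcg_gammaE dotcC dotc_herm. Qed.

Lemma pcg_den_conj i : (den i)^* = den i.
Proof. by rewrite dotcC -dotc_herm. Qed.

(** By the direction update, [T *m r l] is a combination of [p l] and, for positive [l], of the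
    direction before it. *)
Lemma pcg_orth_Tr i u l :
  (forall j, (j < i)%N -> dotc u (p j) = 0) -> (l < i)%N ->
  dotc u (T *m r l) = 0.
Proof.
move=> hu; case: l => [|l] hl; first exact: (hu 0%N).
have -> : T *m r l.+1 = p l.+1 - (g l.+1 / g l) *: p l by rewrite pcg_pS addrK.
by rewrite dotcBr dotcZr !hu ?mulr0 ?subr0 // ltnW.
Qed.

(** The residual update makes [Al *m p j] a multiple of [r j - r j.+1], so [T *m (Al *m p j)] lies
    in the span of the directions up to [j.+1]. *)
Lemma pcg_orth_TAlp i u j : g j != 0 -> den j != 0 ->
  (forall l, (l < i)%N -> dotc u (p l) = 0) -> (j.+1 < i)%N ->
  dotc u (T *m (Al *m p j)) = 0.
Proof.
move=> gj dj hu hj; apply: (mulfI (mulf_neq0 gj (invr_neq0 dj))).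
rewrite mulr0 -dotcZr scalemxAr.
have -> : (g j / den j) *: (Al *m p j) = r j - r j.+1 by rewrite pcg_rS subKr.
by rewrite mulmxBr dotcBr !(pcg_orth_Tr hu) ?subr0 // ltnW.
Qed.

(** Orthogonality of residuals and conjugacy of directions each need the other at the previous
    index, so the induction carries both. *)
Definition pcg_conjugate i := forall j, (j < i)%N ->
  dotc (r i) (p j) = 0 /\ dotc (Al *m p i) (p j) = 0.

Lemma pcg_conjugate_rp i : pcg_conjugate i -> dotc (r i) (p i) = g i.
Proof.
case: i => [_|i hi]; first by rewrite pcg_gammaE dotc_herm.
rewrite pcg_pS dotcDr dotcZr (hi i _).1 // mulr0 addr0.
by rewrite pcg_gammaE dotc_herm.
Qed.

(** Against [p i] the step length is the one that cancels; against earlier directions both terms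
    vanish. It is separate from conjugacy because definedness up to [k] gives a nonzero [g j] only
    for [j.+1 < k], which still suffices for the residual at [k]. *)
Lemma pcg_residual_orth i : pcg_conjugate i -> den i != 0 ->
  forall j, (j < i.+1)%N -> dotc (r i.+1) (p j) = 0.
Proof.
move=> hi di j; rewrite ltnS leq_eqVlt pcg_rS dotcBl dotcZl.
rewrite rmorphM fmorphV /= pcg_gamma_conj pcg_den_conj.
case/orP => [/eqP ->|/hi [-> ->]]; last by rewrite mulr0 subr0.
by rewrite pcg_conjugate_rp // -[dotc _ _]/(den i) divfK // subrr.
Qed.

Lemma pcg_conjugateS i : pcg_conjugate i ->
  (forall j, (j < i.+1)%N -> den j != 0) ->
  (forall j, (j < i.+1)%N -> g j != 0) -> pcg_conjugate i.+1.
Proof.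
move=> hi hd hg j hj; have horth := pcg_residual_orth hi (hd i (ltnSn i)).
split; first exact: horth.
rewrite pcg_pS mulmxDr dotcDl -scalemxAr dotcZl rmorphM fmorphV /=.
rewrite !pcg_gamma_conj dotc_herm // dotc_herm //.
move: hj; rewrite ltnS leq_eqVlt => /orP[/eqP ->|hj]; last first.
  rewrite (hi j hj).2 mulr0 addr0.
  apply: pcg_orth_TAlp horth _ => //; [apply: hg | apply: hd]; exact: ltnW.
have gi := hg i (ltnSn i); have di := hd i (ltnSn i).
rewrite -[dotc (Al *m p i) (p i)]/(den i).
(* After scaling by the step length, the first term becomes [- g i.+1], and the coefficient
   [g i.+1 / g i] in the direction update is what cancels it. *)
apply: (mulfI (mulf_neq0 gi (invr_neq0 di))).
rewrite mulr0 mulrDr -dotcZr scalemxAr.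
have -> : (g i / den i) *: (Al *m p i) = r i - r i.+1 by rewrite pcg_rS subKr.
rewrite mulmxBr dotcBr (pcg_orth_Tr horth) // -[dotc _ _]dotc_herm // -pcg_gammaE.
by field; rewrite gi.
Qed.

Lemma pcg_conjugateP i : (forall j, (j < i)%N -> den j != 0) ->
  (forall j, (j < i)%N -> g j != 0) -> pcg_conjugate i.
Proof.
elim: i => [|i IH] hd hg //; apply: pcg_conjugateS => //.
by apply: IH => j hj; [apply: hd | apply: hg]; exact: ltnW.
Qed.

Lemma pcg_defined_residual_orth k : pcg_defined Al T x0 k ->
  forall j, (j < k)%N -> dotc (r k) (p j) = 0.
Proof.
case: k => [//|k] [hd hg]; apply: pcg_residual_orth; last exact: (hd k).
by apply: pcg_conjugateP => j hj; [apply: hd; exact: ltnW | exact: hg].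
Qed.

(** One factor [T *m Al] is moved to the left argument at each induction step. The new vector
    [Al *m (T *m u)] is orthogonal to one direction fewer, which is why [k] and [u] are
    generalised. *)
Lemma pcg_orth_krylov k m u : pcg_defined Al T x0 k ->
  (forall j, (j < k)%N -> dotc u (p j) = 0) -> (m < k)%N ->
  dotc u (iter m.+1 (mulmx (T *m Al)) x0) = 0.
Proof.
elim: m k u => [|m IH] [|k] u //= [hd hg] hu hm.
  have -> : T *m Al *m x0 = - p 0%N by rewrite /pcg_p /= mulmxN opprK mulmxA.
  by rewrite dotcNr hu // oppr0.
rewrite -mulmxA -dotc_herm // -dotc_herm //; apply: (IH k) => //.
  by split=> j hj; [apply: hd | apply: hg]; apply: leq_trans hj _.
move=> j hj; rewrite dotc_herm // dotc_herm //.
apply: (pcg_orth_TAlp (i := k.+1)) => //; [exact: hg | apply: hd; exact: ltnW].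
Qed.

Lemma pcg_orth_correction k u :
  (forall j, (j < k)%N -> dotc u (p j) = 0) -> dotc u (x k - x0) = 0.
Proof.
elim: k => [|k IH] hu; first by rewrite subrr dotc0r.
rewrite pcg_xS addrAC dotcDr dotcZr hu // mulr0 addr0.
by apply: IH => j hj; apply: hu; exact: ltnW.
Qed.

(* The residual at [x k] is orthogonal to the Krylov space, so [x k] minimises
   the energy [dotc y (Al *m y)] over [x0 + K_k]. *)
Lemma pcg_optimal k (c : nat -> C) (y : 'cV[C]_n) :
  (forall v : 'cV[C]_n, 0 <= dotc v (Al *m v)) ->
  pcg_defined Al T x0 k -> c 0%N = 1 ->
  y = \sum_(j < k.+1) c j *: iter j (mulmx (T *m Al)) x0 ->
  dotc (x k) (Al *m x k) <= dotc y (Al *m y).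
Proof.
move=> psd hk c0 hy; have [e he] : exists e, e = y - x k by eexists.
have horth := pcg_defined_residual_orth hk.
have re0 : dotc (r k) e = 0.
  rewrite (_ : e = (y - x0) - (x k - x0)); last by rewrite he opprB addrA subrK.
  rewrite dotcBr pcg_orth_correction // subr0.
  rewrite hy big_ord_recl c0 scale1r addrAC subrr add0r dotc_sumr big1 // => j _.
  by rewrite dotcZr (pcg_orth_krylov hk) ?mulr0.
have xe0 : dotc (Al *m x k) e = 0 by rewrite -[Al *m _]opprK -pcg_rE dotcNl re0 oppr0.
have -> : y = x k + e by rewrite he addrC subrK.
(* The cross terms vanish, so the energy of [y] is that of [x k] plus the nonnegative energy of
   [e]. *)
rewrite mulmxDr !dotcDr !dotcDl -(dotc_herm (x k) e) // xe0 add0r.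
rewrite -[dotc e (Al *m x k)]dotcC xe0 conjC0 addr0.
by rewrite lerDl.
Qed.

End ConjugateGradients.

(** * Chebyshev polynomials through their recurrence *)

Section Chebyshev.
Variable F : realFieldType.
Implicit Types (t a b : F).

Lemma cheb_pairE k : @cheb_pair F k = (chebyshev k, chebyshev k.+1).
Proof. by rewrite /chebyshev /=; case: (cheb_pair k). Qed.

Lemma chebyshevSS k :
  chebyshev k.+2 = 2%:R *: 'X * chebyshev k.+1 - chebyshev k :> {poly F}.
Proof. by rewrite {1}/chebyshev /= cheb_pairE. Qed.

Lemma chebyshev_hornerSS k t :
  (chebyshev k.+2).[t] = 2%:R * t * (chebyshev k.+1).[t] - (chebyshev k).[t].
Proof. by rewrite chebyshevSS !hornerE. Qed.

Lemma size_chebyshev k : (size (chebyshev k : {poly F}) <= k.+1)%N.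
Proof.
suff /(_ k) [] : forall j, (size (chebyshev j : {poly F}) <= j.+1)%N /\
    (size (chebyshev j.+1 : {poly F}) <= j.+2)%N by [].
elim=> [|j [IH1 IH2]].
  by split; rewrite /chebyshev /= ?size_poly1 ?size_polyX.
split=> //; rewrite chebyshevSS (leq_trans (size_polyD _ _)) // geq_max size_polyN.
rewrite (leq_trans IH1 (leqW (leqnSn _))) andbT.
rewrite -scalerAl (leq_trans (size_scale_leq _ _)) // mulrC.
by rewrite (leq_trans (size_polyMleq _ _)) // size_polyX addn2.
Qed.

(** A quantity conserved by the recurrence. For [t] the cosine of an angle it is the identity
    relating the cosines of two consecutive multiples, and it replaces the trigonometric form. *)
Lemma chebyshev_invariant k t :
  let a := (chebyshev k).[t] in let b := (chebyshev k.+1).[t] in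
  a ^+ 2 + b ^+ 2 - 2%:R * t * a * b = 1 - t ^+ 2.
Proof.
elim: k => [|k IH] /=; first by rewrite /chebyshev /= !hornerE; ring.
by move: IH => /= <-; rewrite chebyshev_hornerSS; ring.
Qed.

Lemma chebyshev_le1 k t : -1 <= t <= 1 -> (chebyshev k).[t] ^+ 2 <= 1.
Proof.
move=> /andP[h1 h2]; have t1 : 0 <= 1 - t ^+ 2 by nra.
(* At the endpoints the identity [e] below degenerates to 0 = 0, so the value is computed outright
   as [t ^+ k]. *)
have [t2|t2] := eqVneq (1 - t ^+ 2) 0.
  have t21 : t ^+ 2 = 1 by lra.
  suff -> : (chebyshev k).[t] = t ^+ k by rewrite -exprM mulnC exprM t21 expr1n.
  elim: k => [|k IH]; first by rewrite /chebyshev /= hornerE.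
  have := chebyshev_invariant k t; rewrite /= t2 IH [t ^+ k.+1]exprS => /eqP.
  set u := t ^+ k; set v := _.[t] => h.
  have : (v - t * u) ^+ 2 = 0.
    transitivity (u ^+ 2 + v ^+ 2 - 2%:R * t * u * v + (t ^+ 2 - 1) * u ^+ 2).
      by ring.
    by rewrite (eqP h) t21; ring.
  by move/eqP; rewrite sqrf_eq0 subr_eq0 => /eqP.
have {}t1 : 0 < 1 - t ^+ 2 by rewrite lt_def t2.
have /= := chebyshev_invariant k t.
set u := (chebyshev k).[t]; set v := _.[t] => h.
(* The invariant with the square completed in [v]. *)
have e : (1 - t ^+ 2) * (1 - u ^+ 2) = (v - t * u) ^+ 2.
  rewrite mulrBr mulr1 -{1}h; ring.
rewrite -subr_ge0 -(pmulr_rge0 _ t1) e; exact: sqr_ge0.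
Qed.

(** At a fixed [t] at least 1 the values do not decrease with the degree, which the induction proves
    alongside. *)
Lemma chebyshev_ge1 k t : 1 <= t -> 1 <= (chebyshev k).[t].
Proof.
move=> t1; suff /(_ k) [] : forall j, 1 <= (chebyshev j).[t] /\
    (chebyshev j).[t] <= (chebyshev j.+1).[t] by [].
elim=> [|j [IH1 IH2]]; first by rewrite /chebyshev /= !hornerE.
by split; [lra | rewrite chebyshev_hornerSS; nra].
Qed.

Lemma chebyshev_extremal k a b : 0 < a -> a < b ->
  exists q : {poly F}, [/\ (size q <= k.+1)%N, q.[0] = 1 &
    forall t, a <= t <= b ->
      q.[t] ^+ 2 <= (chebyshev k).[(b + a) / (b - a)] ^- 2].
Proof.
move=> a0 ab; set phi := _ / _.
have ba : 0 < b - a by rewrite subr_gt0.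
have phi1 : 1 <= phi by rewrite ler_pdivlMr // mul1r; lra.
have c1 := chebyshev_ge1 k phi1.
have c0 : (chebyshev k).[phi] != 0 by apply: lt0r_neq0; lra.
(* The affine map reversing [[a, b]] onto [[-1, 1]]; it sends 0 to [phi], so dividing by the
   Chebyshev value there normalises [q] at 0. *)
pose l : {poly F} := phi%:P - (2%:R / (b - a)) *: 'X.
exists ((chebyshev k).[phi]^-1 *: (chebyshev k \Po l)); split.
- rewrite (leq_trans (size_scale_leq _ _)) //.
  rewrite (leq_trans (size_comp_poly_leq _ _)) // ltnS.
  have sl : ((size l).-1 <= 1)%N.
    rewrite -subn1 leq_subLR (leq_trans (size_polyD _ _)) // geq_max size_polyN.
    rewrite (leq_trans (size_polyC_leq1 _)) //.
    by rewrite (leq_trans (size_scale_leq _ _)) // size_polyX.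
  have sc : ((size (chebyshev k : {poly F})).-1 <= k)%N.
    by rewrite -subn1 leq_subLR size_chebyshev.
  by rewrite (leq_trans (leq_mul sc sl)) // muln1.
- have l0 : l.[0] = phi.
    by rewrite /l hornerD hornerC hornerN hornerZ hornerX mulr0 subr0.
  by rewrite hornerZ horner_comp l0 mulVf.
- move=> t /andP[ta tb]; rewrite hornerZ horner_comp exprMn exprVn.
  rewrite ler_piMr ?invr_ge0 ?sqr_ge0 //; apply: chebyshev_le1.
  have -> : l.[t] = (b + a - 2%:R * t) / (b - a).
    by rewrite !hornerE /phi; field; rewrite gt_eqF.
  by rewrite ler_pdivlMr // ler_pdivrMr // mul1r mulN1r; lra.
Qed.

End Chebyshev.

(** * Energy contraction and the spectrum of the preconditioned matrix *)

Section EnergyBounds.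
Variable R : realType.
Local Notation C := R[i].

(** The alternative [w i 0 = 0] allows a comparison that fails on some eigendirections, such as the
    kernel of [Al], once these are projected out. *)
Lemma cdiag_form_le n (P A B : 'M[C]_n) (d e : 'I_n -> R) (a b : R) (w : 'cV[C]_n) :
  P ^t* *m A *m P = cdiag d -> P ^t* *m B *m P = cdiag e ->
  (forall i, w i 0 = 0 \/ a * d i <= b * e i) ->
  (a%:C)%C * dotc (P *m w) (A *m (P *m w)) <=
  (b%:C)%C * dotc (P *m w) (B *m (P *m w)).
Proof.
move=> hA hB h; rewrite (dotc_cdiag _ hA) (dotc_cdiag _ hB) !mulr_sumr.
apply: ler_sum => i _; case: (h i) => [->|hi].
  by rewrite normr0 expr0n !mulr0.
by rewrite [leLHS]mulrA [leRHS]mulrA ler_wpM2r ?exprn_ge0 // -!rmorphM lecR.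
Qed.

Lemma cdiag_form_ge0 n (P A : 'M[C]_n) (d : 'I_n -> R) (v : 'cV[C]_n) :
  P \in unitmx -> P ^t* *m A *m P = cdiag d -> (forall i, 0 <= d i) ->
  0 <= dotc v (A *m v).
Proof.
move=> uP hA h; rewrite -(mulKVmx uP v) (dotc_cdiag _ hA) sumr_ge0 // => i _.
by rewrite mulr_ge0 ?ler0c ?exprn_ge0.
Qed.

Lemma cdiag_form_gt0 n (P A : 'M[C]_n) (d : 'I_n -> R) :
  P \in unitmx -> P ^t* *m A *m P = cdiag d -> (forall i, 0 < d i) -> posdef A.
Proof.
move=> uP hA h v v0; rewrite lt_def (cdiag_form_ge0 v uP hA) ?andbT; last first.
  by move=> i; apply: ltW.
apply: contraNneq v0; rewrite -(mulKVmx uP v) (dotc_cdiag _ hA) => /eqP.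
rewrite psumr_eq0 => [|i _]; last by rewrite mulr_ge0 ?ler0c ?exprn_ge0 // ltW.
move/allP => z0; suff -> : invmx P *m v = 0 by rewrite mulmx0.
apply/colP => i; rewrite [RHS]mxE; have := z0 i (mem_index_enum i).
rewrite /= mulf_eq0 sqrf_eq0 normr_eq0.
by rewrite -[0]/((0%:C)%C) (inj_eq (@complexI R)) gt_eqF //= => /eqP.
Qed.

Lemma cdiag_kernel n (P A : 'M[C]_n) (d : 'I_n -> R) (v : 'cV[C]_n) :
  P \in unitmx -> P ^t* *m A *m P = cdiag d -> (forall i, 0 <= d i) ->
  dotc v (A *m v) <= 0 -> A *m v = 0.
Proof.
move=> uP hA h; rewrite -{1 2}(mulKVmx uP v) (dotc_cdiag _ hA) => le0.
have ge0 i : 0 <= ((d i)%:C)%C * `|(invmx P *m v) i 0| ^+ 2.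
  by rewrite mulr_ge0 ?ler0c ?exprn_ge0.
have /eqP : \sum_i ((d i)%:C)%C * `|(invmx P *m v) i 0| ^+ 2 = 0.
  by apply: le_anti; rewrite le0 sumr_ge0.
rewrite psumr_eq0 // => /allP z0.
have uPt : P ^t* \in unitmx by rewrite map_unitmx unitmx_tr.
apply: (can_inj (mulKmx uPt)); rewrite mulmx0 -{1}(mulKVmx uP v) !mulmxA hA.
apply/colP => i; rewrite -mulmxA mul_diag_mx [LHS]mxE [RHS]mxE.
have := z0 i (mem_index_enum i); rewrite /= mulf_eq0 sqrf_eq0 normr_eq0 !mxE.
by case/orP => /eqP ->; rewrite ?mul0r ?mulr0.
Qed.

(** [T *m Al] is [P *m cdiag d *m invmx P], so [q] of it multiplies the coordinate [i] of [x0] by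
    [q.[d i]]. The factor [d i] in the last hypothesis makes that condition automatic on the kernel
    of [Al]. *)
Lemma pcg_energy_bound n (Al T P : 'M[C]_n) (d : 'I_n -> R) (x0 : 'cV[C]_n)
    k (q : {poly R}) (e : R) :
  Al \is hermsymmx -> T \is hermsymmx -> P \in unitmx -> T = P *m P ^t* ->
  P ^t* *m Al *m P = cdiag d -> (forall i, 0 <= d i) ->
  pcg_defined Al T x0 k -> (size q <= k.+1)%N -> q.[0] = 1 ->
  (forall i, q.[d i] ^+ 2 * d i <= e * d i) ->
  dotc (pcg_x Al T x0 k) (Al *m pcg_x Al T x0 k) <=
  (e%:C)%C * dotc x0 (Al *m x0).
Proof.
move=> hAl hT uP eT eAl d0 hk sq q0 hq; pose z := invmx P *m x0.
have ex0 : x0 = P *m z by rewrite mulKVmx.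
have krylov j : iter j (mulmx (T *m Al)) x0 =
    P *m (\col_i ((((d i) ^+ j)%:C)%C * z i 0)).
  elim: j => [|j IH].
    by rewrite /= {1}ex0; congr (_ *m _); apply/colP => i; rewrite !mxE mul1r.
  rewrite iterS IH eT -!mulmxA; congr (_ *m _); rewrite !mulmxA eAl.
  apply/colP => i; rewrite mul_diag_mx !mxE exprS rmorphM.
  by rewrite !mulrA.
pose w : 'cV[C]_n := \col_i (((q.[d i])%:C)%C * z i 0).
have ey : P *m w =
    \sum_(j < k.+1) ((q`_j)%:C)%C *: iter j (mulmx (T *m Al)) x0.
  under eq_bigr do rewrite krylov scalemxAr.
  rewrite -mulmx_sumr; congr (_ *m _); apply/colP => i.
  rewrite summxE mxE (horner_coef_wide _ sq) rmorph_sum mulr_suml.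
  by apply: eq_bigr => j _; rewrite !mxE rmorphM mulrA.
apply: le_trans (pcg_optimal (c := fun j => ((q`_j)%:C)%C) hAl hT _ hk _ ey) _.
- by move=> v; apply: cdiag_form_ge0 uP eAl d0.
- by rewrite -horner_coef0 q0.
rewrite {1 2}ex0 !(dotc_cdiag _ eAl) mulr_sumr; apply: ler_sum => i _.
rewrite mxE normrM exprMn [leLHS]mulrA [leRHS]mulrA ler_wpM2r ?exprn_ge0 //.
have -> : `|((q.[d i])%:C)%C| ^+ 2 = ((q.[d i] ^+ 2)%:C)%C :> C.
  by rewrite rmorphXn real_normK //; apply/complex_realP; eexists.
by rewrite -!rmorphM lecR mulrC.
Qed.

Lemma mx_eigenvalues_pencil n (B : 'M[C]_n) mu :
  mx_eigenvalues B mu -> pencil_eigenvalues B 1%:M mu.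
Proof.
case=> chi hmu; split=> //; rewrite det1 scale1r -chi /pencil_charpoly.
congr (\det (_ - _)); apply/matrixP => i j; rewrite !mxE.
by case: eqP => _; rewrite ?mulr1n ?mulr0n ?scale1r ?scale0r.
Qed.

Lemma mx_eigenvalues_form n (B : 'M[C]_n) mu : B \is hermsymmx ->
  mx_eigenvalues B mu -> forall w : 'cV[C]_n,
  ((mu 0%N)%:C)%C * dotc w w <= dotc w (B *m w) <= ((mu n.-1)%:C)%C * dotc w w.
Proof.
move=> hB hmu w; have [V [d [uV1 uV2 eB]]] := hermitian_diag hB.
have e1 : V ^t* *m 1%:M *m V = cdiag (fun=> 1).
  rewrite mulmx1 uV1 -diag_const_mx; congr diag_mx.
  by apply/rowP => i; rewrite !mxE.
have e1' : V ^t* *m 1%:M *m V = 1%:M by rewrite mulmx1.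
have [s es] := pencil_diag_perm e1' eB (mx_eigenvalues_pencil hmu).
have ew : w = V *m (V ^t* *m w) by rewrite mulmxA uV2 mul1mx.
have dE i : mu 0%N <= d i <= mu n.-1.
  have [_ mono] := hmu; rewrite es; case: (s i) => m hm /=.
  have n0 : (0 < n)%N by apply: leq_trans hm.
  by rewrite !mono ?hm // prednK // leqnn -ltnS prednK // hm.
have := cdiag_form_le (a := mu 0%N) (b := 1) (w := V ^t* *m w) e1 eB.
have := cdiag_form_le (a := 1) (b := mu n.-1) (w := V ^t* *m w) eB e1.
rewrite -ew mul1mx !mul1r => -> => [->//|] i; rewrite !(mul1r, mulr1); right;
  by case/andP: (dE i).
Qed.

(* With [c2] and [cn] the values of [t |-> (t - lam1) / (t - sigma)] at [lam2]
   and [lamn], the pencil gives [Al <= cn As] everywhere and [c2 As <= Al] off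
   the kernel of [Al]. *)
Lemma pencil_form_bounds n (A M : 'M[C]_n) lam sigma :
  A \is hermsymmx -> M \is hermsymmx -> posdef M -> (1 < n)%N ->
  pencil_eigenvalues A M lam -> lam 0%N < lam 1%N -> sigma < lam 0%N ->
  let Al := A - ((lam 0%N)%:C)%C *: M in
  let As := A - (sigma%:C)%C *: M in
  let c2 := (lam 1%N - lam 0%N) / (lam 1%N - sigma) in
  let cn := (lam n.-1 - lam 0%N) / (lam n.-1 - sigma) in
  [/\ posdef As, forall u, dotc u (Al *m u) <= (cn%:C)%C * dotc u (As *m u),
      forall u : 'cV[C]_n, 0 <= dotc u (Al *m u) &
      exists v : 'cV[C]_n, Al *m v = 0 /\ forall u, exists a,
        (c2%:C)%C * dotc (u - a *: v) (As *m (u - a *: v)) <=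
        dotc (u - a *: v) (Al *m (u - a *: v))].
Proof.
move=> hA hM pM n1 hlam l01 sl Al As c2 cn.
have [P [d [uP eM eA]]] := pencil_diag hA hM pM.
have [s es] := pencil_diag_perm eM eA hlam; have [_ mono] := hlam.
have n0 : (0 < n)%N := ltnW n1.
have eX (a : R) : P ^t* *m (A - (a%:C)%C *: M) *m P = cdiag (fun i => d i - a).
  rewrite mulmxBr mulmxBl -scalemxAr -scalemxAl eM eA scalemx1 -diag_const_mx.
  by rewrite -raddfB; congr diag_mx; apply/rowP => i; rewrite !mxE rmorphB.
have eAl : P ^t* *m Al *m P = cdiag (fun i => d i - lam 0%N) by exact: eX.
have eAs : P ^t* *m As *m P = cdiag (fun i => d i - sigma) by exact: eX.
have dge i : lam 0%N <= d i by rewrite es mono ?leq0n /=.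
have dle i : d i <= lam n.-1.
  by rewrite es mono // prednK // leqnn -ltnS prednK // ltn_ord.
(* The position of the simple smallest eigenvalue; [lam] counts from 0, so [lam 0] is the first
   eigenvalue and [lam n.-1] the last. *)
pose i0 : 'I_n := (s^-1)%g (Ordinal n0).
have d0 : d i0 = lam 0%N by rewrite es permKV.
have dge2 i : i != i0 -> lam 1%N <= d i.
  move=> ii0; rewrite es mono // ltn_ord andbT lt0n.
  apply: contraNneq ii0 => si0; apply/eqP/(@perm_inj _ s).
  by rewrite permKV; apply: val_inj.
have lamn : lam 1%N <= lam n.-1.
  by rewrite mono // prednK // leqnn -ltnS prednK // n1.
split.
- by apply: cdiag_form_gt0 uP eAs _ => i; rewrite subr_gt0 (lt_le_trans sl).
- move=> u; rewrite -(mulKVmx uP u) -[leLHS]mul1r.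
  apply: cdiag_form_le eAl eAs _ => i; right; rewrite mul1r /cn.
  (* With the denominator cleared, the two sides differ by [(lam n.-1 - d i) * (lam 0 - sigma)]. *)
  rewrite mulrAC ler_pdivlMr; last by lra.
  have := dge i; have := dle i; nra.
- by move=> u; apply: cdiag_form_ge0 uP eAl _ => i; rewrite subr_ge0.
(* The column [i0] of [P] is an eigenvector for [lam 0]. Subtracting the matching coordinate of [u]
   times this column removes the one direction where the comparison fails. *)
- exists (P *m delta_mx i0 0); split.
    have uPt : P ^t* \in unitmx by rewrite map_unitmx unitmx_tr.
    apply: (can_inj (mulKmx uPt)); rewrite mulmx0 !mulmxA eAl.
    apply/colP => i; rewrite mul_diag_mx !mxE; case: (eqVneq i i0) => [->|_].
      by rewrite d0 subrr mul0r.
    by rewrite mulr0.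
  move=> u; exists ((invmx P *m u) i0 0); set w := invmx P *m u.
  have -> : u - w i0 0 *: (P *m delta_mx i0 0) = P *m (w - w i0 0 *: delta_mx i0 0).
    by rewrite mulmxBr scalemxAr mulKVmx.
  rewrite -[leRHS]mul1r; apply: cdiag_form_le eAs eAl _ => i.
  have [->|ii0] := eqVneq i i0; [left|right].
    by rewrite !mxE !eqxx mulr1 subrr.
  rewrite mul1r /c2 mulrAC ler_pdivrMr; last by lra.
  have := dge2 i ii0; nra.
Qed.

Lemma preconditioned_spectrum n (Al As S V : 'M[C]_n) (mu : nat -> R) (c2 cn : R)
    (v : 'cV[C]_n) (d : 'I_n -> R) :
  Al \is hermsymmx -> As \is hermsymmx -> S \is hermsymmx -> S \in unitmx ->
  mx_eigenvalues (S *m As *m S) mu -> 0 <= c2 -> 0 <= cn -> 0 <= mu 0%N ->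
  (forall u, dotc u (Al *m u) <= (cn%:C)%C * dotc u (As *m u)) ->
  Al *m v = 0 ->
  (forall u, exists a,
        (c2%:C)%C * dotc (u - a *: v) (As *m (u - a *: v)) <=
        dotc (u - a *: v) (Al *m (u - a *: v))) ->
  V ^t* *m V = 1%:M -> V *m V ^t* = 1%:M ->
  V ^t* *m (S *m Al *m S) *m V = cdiag d ->
  forall i, d i = 0 \/ mu 0%N * c2 <= d i <= mu n.-1 * cn.
Proof.
move=> hAl hAs hS uS hmu c20 cn0 mu0 hup v0 hlow uV1 uV2 eB i.
have [->|di] := eqVneq (d i) 0; [by left|right].
have hB : S *m As *m S \is hermsymmx.
  by have := herm_conj S hAs; rewrite (hermsymmxP hS).
have hform := mx_eigenvalues_form hB hmu.
(* [y] is a unit eigenvector of [S *m Al *m S] for [d i], so [u] has energy [d i]. *)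
pose y : 'cV[C]_n := V *m delta_mx i 0; pose u := S *m y.
have yy : dotc y y = 1.
  rewrite dotc_mull mulmxA uV1 mul1mx dotcE (bigD1 i) //= big1 ?addr0.
    by rewrite !mxE !eqxx conjC1 mulr1.
  by move=> j /negPf ne; rewrite !mxE ne mulr0.
have By : S *m (Al *m u) = ((d i)%:C)%C *: y.
  have uVt : V ^t* \in unitmx by case: (mulmx1_unit uV1).
  apply: (can_inj (mulKmx uVt)); rewrite /u /y -scalemxAr !mulmxA uV1 mul1mx.
  rewrite -(mulmxA (V ^t*)) -(mulmxA (V ^t*)) eB.
  apply/colP => j; rewrite mul_diag_mx !mxE.
  by case: (eqVneq j i) => [->//|_]; rewrite !mulr0.
have uu : dotc u (Al *m u) = ((d i)%:C)%C.
  by rewrite dotc_herm // By dotcZr yy mulr1.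
have formS w : dotc (S *m w) (As *m (S *m w)) = dotc w (S *m As *m S *m w).
  by rewrite dotc_herm // !mulmxA.
rewrite -!lecR; apply/andP; split; last first.
  rewrite -uu (le_trans (hup u)) // mulrC rmorphM ler_wpM2r ?ler0c // formS.
  by have /andP[_] := hform y; rewrite yy mulr1.
(* [h] lies in the kernel of [S *m Al *m S], hence is orthogonal to [y], whose eigenvalue is
   nonzero. By Pythagoras, subtracting [a *: h] cannot shorten [y]. *)
have [a ha] := hlow u; pose h := invmx S *m v.
have eh : u - a *: v = S *m (y - a *: h).
  by rewrite mulmxBr -scalemxAr mulKVmx.
have hy : dotc y h = 0.
  have : dotc (S *m (Al *m u)) h = 0.
    by rewrite dotc_herm // mulKVmx // dotc_herm // v0 dotc0r.
  rewrite By dotcZl conj_real_complex => /eqP; rewrite mulf_eq0.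
  by rewrite -[0 in X in X || _]/((0%:C)%C) (inj_eq (@complexI R)) (negPf di) => /eqP.
have hy' : dotc h y = 0 by rewrite -dotcC hy conjC0.
have ge1 : 1 <= dotc (y - a *: h) (y - a *: h).
  rewrite dotcBl !dotcBr yy !dotcZl !dotcZr hy hy' !mulr0 subr0 sub0r opprK.
  by rewrite lerDl mulrA mulr_ge0 ?dotc_ge0 // mulrC mul_conjC_ge0.
have aa : dotc (u - a *: v) (Al *m (u - a *: v)) = ((d i)%:C)%C.
  rewrite mulmxBr -scalemxAr v0 scaler0 subr0 dotcBl dotcZl.
  by rewrite -(dotc_herm v u) // v0 dotc0l mulr0 subr0.
rewrite -aa (le_trans _ ha) // eh formS mulrC rmorphM ler_wpM2l ?ler0c //.
have /andP[+ _] := hform (y - a *: h); apply: le_trans.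
by rewrite ler_peMr ?ler0c.
Qed.

End EnergyBounds.

(** * Contraction of the energy and of the Rayleigh quotient *)

Theorem theorem2p2 (R : realType) (n : nat) (A M : 'M[R[i]]_n) (lam : nat -> R)
  (sigma : R) (T S : 'M[R[i]]_n) (mu : nat -> R) (x0 : 'cV[R[i]]_n) :
  A \is hermsymmx -> M \is hermsymmx -> posdef M ->
  (1 < n)%N -> pencil_eigenvalues A M lam -> lam 0%N < lam 1%N ->
  sigma < lam 0%N ->
  T \is hermsymmx -> posdef T ->
  (* S = T^{1/2}: the Hermitian positive definite square root of T *)
  S \is hermsymmx -> posdef S -> S *m S = T ->
  (* mu: eigenvalues of T^{1/2} A_sigma T^{1/2}, nondecreasing *)
  mx_eigenvalues (S *m (A - (sigma%:C)%C *: M) *m S) mu ->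
  (* x0 is not an eigenvector for lam_1 ... *)
  A *m x0 != ((lam 0%N)%:C)%C *: (M *m x0) ->
  (* ... and not M-orthogonal to the lam_1-eigenspace *)
  (exists v : 'cV[R[i]]_n, A *m v = ((lam 0%N)%:C)%C *: (M *m v)
                            /\ dotc v (M *m x0) != 0) ->
  let Al := A - ((lam 0%N)%:C)%C *: M in
  let kappa := mu n.-1 / mu 0%N in
  let eta := kappa * ((lam n.-1 - lam 0%N) * (lam 1%N - sigma))
                   / ((lam 1%N - lam 0%N) * (lam n.-1 - sigma)) in
  let phi := (eta + 1) / (eta - 1) in
  forall k : nat,
    pcg_defined Al T x0 k ->
    pcg_x Al T x0 k != 0 ->
    rayleigh A M (pcg_x Al T x0 k) - ((lam 0%N)%:C)%C
    <= (((chebyshev k).[phi] ^- 2 : R)%:C)%C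
       * (normM2 M x0 / normM2 M (pcg_x Al T x0 k))
       * (rayleigh A M x0 - ((lam 0%N)%:C)%C).
Proof.
move=> hA hM pM n1 hlam l01 sl hT pT hS pS eT hmu ex0 _ Al kappa eta phi k hk xk0.
have n0 : (0 < n)%N := ltnW n1.
have [pAs hup psd [v [v0 hlow]]] := pencil_form_bounds hA hM pM n1 hlam l01 sl.
set As := A - (sigma%:C)%C *: M in hmu pAs hup hlow.
rewrite -/Al in hup psd v0 hlow.
set c2 := (_ / (lam 1%N - _)) in hlow; set cn := (_ / _) in hup.
have hshift (a : R) : A - (a%:C)%C *: M \is hermsymmx.
  apply/hermsymmxP; rewrite linearB linearZ /= map_mxB map_mxZ.
  rewrite (hermsymmxP hA) (hermsymmxP hM); congr (_ - _ *: _).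
  exact: conj_real_complex.
have hAl : Al \is hermsymmx := hshift _; have hAs : As \is hermsymmx := hshift _.
have uS := posdef_unitmx hS pS.
have lamn : lam 1%N <= lam n.-1.
  by rewrite hlam.2 // prednK // leqnn -ltnS prednK // n1.
have mun : mu 0%N <= mu n.-1 by rewrite hmu.2 // prednK // leqnn.
have mu0 : 0 < mu 0%N.
  have hB : S *m As *m S \is hermsymmx.
    by have := herm_conj S hAs; rewrite (hermsymmxP hS).
  have [W [e [uW1 _ eW]]] := hermitian_diag hB.
  have [_ uW] := mulmx1_unit uW1.
  have eW1 : W ^t* *m 1%:M *m W = 1%:M by rewrite mulmx1.
  have [s es] := pencil_diag_perm eW1 eW (mx_eigenvalues_pencil hmu).
  have := es ((s^-1)%g (Ordinal n0)); rewrite permKV /= => <-.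
  apply: (posdef_diag_gt0 _ uW eW) => w w0.
  rewrite -!mulmxA -dotc_herm //; apply: pAs.
  by apply: contra_neq w0 => /(congr1 (mulmx (invmx S))); rewrite mulKmx // mulmx0.
have c20 : 0 < c2 by rewrite divr_gt0 // subr_gt0 // (lt_trans sl).
have c2n : c2 <= cn.
  rewrite /c2 /cn ler_pdivrMr; last by lra.
  rewrite mulrAC ler_pdivlMr; last by lra.
  nra.
have hB : S *m Al *m S \is hermsymmx.
  by have := herm_conj S hAl; rewrite (hermsymmxP hS).
have [V [d [uV1 uV2 eB]]] := hermitian_diag hB.
have spec := preconditioned_spectrum hAl hAs hS uS hmu (ltW c20)
  (ltW (lt_le_trans c20 c2n)) (ltW mu0) hup v0 hlow uV1 uV2 eB.
set a := mu 0%N * c2 in spec; set b := mu n.-1 * cn in spec.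
have a0 : 0 < a by rewrite mulr_gt0.
have ab : a <= b by rewrite ler_pM // ltW.
have d0 i : 0 <= d i by case: (spec i) => [->//|/andP[h _]]; apply: le_trans h; apply: ltW.
(* As [V] is unitary, [P] factors [T] as [P *m P ^t*] and also diagonalises [Al] by congruence, as
   [pcg_energy_bound] requires. *)
pose P := S *m V.
have uP : P \in unitmx by rewrite unitmx_mul uS; case: (mulmx1_unit uV1).
have eTP : T = P *m P ^t*.
  by rewrite adjmxM (hermsymmxP hS) !mulmxA -(mulmxA S) uV2 mulmx1 eT.
have eAl : P ^t* *m Al *m P = cdiag d.
  by rewrite -eB adjmxM (hermsymmxP hS) !mulmxA.
have bound j q e := @pcg_energy_bound _ _ _ _ _ _ x0 j q e hAl hT uP eTP eAl d0.
have etaE : eta = b / a.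
  rewrite /eta /kappa /a /b /c2 /cn; field; rewrite !gt_eqF //; lra.
clearbody a b.
have main : dotc (pcg_x Al T x0 k) (Al *m pcg_x Al T x0 k) <=
    (((chebyshev k).[phi] ^- 2 : R)%:C)%C * dotc x0 (Al *m x0).
  move: ab; rewrite le_eqVlt => /orP[/eqP ab|ab]; last first.
    have -> : phi = (b + a) / (b - a).
      by rewrite /phi etaE; field; rewrite !gt_eqF // subr_gt0.
    have [q [sq q0 hq]] := chebyshev_extremal k a0 ab.
    apply: (bound k q) => // i; case: (spec i) => [->|hi]; first by rewrite !mulr0.
    by rewrite ler_wpM2r // hq.
  (* For [a = b] the denominator of [phi] vanishes, so [phi] is the junk value
     [0]; the iteration then stops at its first step. *)
  have phi0 : phi = 0 by rewrite /phi etaE -ab divff ?gt_eqF // subrr invr0 mulr0.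
  case: k hk xk0 => [|k] hk _.
    by rewrite /chebyshev /= hornerE expr1n invr1 mul1r.
  have h1 : pcg_defined Al T x0 1 by split=> // [[|//]] _; apply: hk.1.
  have energy1 : dotc (pcg_x Al T x0 1) (Al *m pcg_x Al T x0 1) <= 0.
    rewrite -[0](mul0r (dotc x0 (Al *m x0))).
    (* This linear polynomial vanishes at [a], now the only possible nonzero eigenvalue. *)
    apply: (bound 1%N (1 - a^-1 *: 'X) 0) => //.
    - rewrite (leq_trans (size_polyD _ _)) // geq_max size_poly1 size_polyN.
      by rewrite (leq_trans (size_scale_leq _ _)) // size_polyX.
    - by rewrite !hornerE ?mulr0 ?subr0.
    - move=> i; case: (spec i) => [->|]; first by rewrite !mulr0.
      rewrite -ab => /le_anti <-.
      by rewrite !hornerE mulVf ?gt_eqF // subrr expr0n !mul0r.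
  (* At index 1 the Chebyshev value at 0 is 0, whose inverse is 0 by convention, so the bound asks
     for exactly [energy1]. *)
  case: k hk => [|k] hk.
    by rewrite phi0 /chebyshev /= hornerX expr0n invr0 mul0r.
  (* From index 2 on, zero energy puts the first iterate in the kernel of [Al]. Its residual and
     next direction vanish, and so does a denominator that definedness keeps nonzero. *)
  have r1 : pcg_r Al T x0 1 = 0.
    by rewrite pcg_rE (cdiag_kernel uP eAl d0 energy1) oppr0.
  have p1 : pcg_p Al T x0 1 = 0.
    by rewrite pcg_pS pcg_gammaE r1 mulmx0 dotc0r mul0r scale0r addr0.
  by have := hk.1 1%N isT; rewrite p1 dotc0r eqxx.
have shiftE x : x != 0 ->
    rayleigh A M x - ((lam 0%N)%:C)%C = dotc x (Al *m x) / dotc x (M *m x).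
  move=> /pM Mx; rewrite /rayleigh mulmxBl dotcBr -scalemxAl dotcZr mulrBl.
  by rewrite mulfK // gt_eqF.
have x00 : x0 != 0 by apply: contraNneq ex0 => ->; rewrite !mulmx0 scaler0.
have Mx0 := pM _ x00; have Mxk := pM _ xk0.
(* Multiplied by the squared [M]-norm of the iterate, the right-hand side loses both norms and
   equals that of [main]. *)
rewrite !shiftE // /normM2 ler_pdivrMr //; apply: le_trans main _.
rewrite le_eqVlt; apply/orP; left; apply/eqP; move: (_ ^- 2)%:C%C => c.
by field; rewrite !gt_eqF.
Qed.
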